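(* Let $X$ be a compact space and let $a,b\in X$. Then $a$ and $b$ are pin equivalent in $X$ if and only if there is a symmetric binary relation $R\subset X^2$ with domain $X$ such that $R$ is closed in $X^2$ and, for all $x\in X$, we have $aRx\Leftrightarrow x=b$ and $bRx\Leftrightarrow x=a$.
   Context: All spaces are assumed to be Hausdorff. Points $a,b$ in a compact space $X$ are pin equivalent (in $X$) if there exist a compact space $Y$, a continuous surjection $f\colon Y\to X$, and a homeomorphism $g\colon Y\to Y$ such that $g(f^{-1}\{a\})=f^{-1}\{b\}$. The domain of a binary relation $R$ is the set of all $x$ such that $xRy$ for some $y$. *)

(* Defs.v *)
From mathcomp Require Import all_boot.
From mathcomp Require Import all_classical topology.

Set Implicit Arguments.
Unset Strict Implicit.
Unset Printing Implicit Defensive.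

Local Open Scope classical_set_scope.

(* All spaces are Hausdorff, so "compact space" means compact Hausdorff space. *)
Definition compact_space (X : topologicalType) : Prop :=
  compact [set: X] /\ hausdorff_space X.

Definition homeomorphism (X Y : topologicalType) (g : X -> Y) : Prop :=
  continuous g /\
  exists h : Y -> X, [/\ continuous h, cancel g h & cancel h g].

Definition pin_equivalent (X : topologicalType) (a b : X) : Prop :=
  exists (Y : topologicalType) (f : Y -> X) (g : Y -> Y),
    [/\ compact_space Y,
        continuous f,
        set_surj [set: Y] [set: X] f,
        homeomorphism g &
        g @` (f @^-1` [set a]) = f @^-1` [set b]].

Definition symmetric_relation (X : Type) (R : set (X * X)) : Prop :=
  forall x y : X, R (x, y) -> R (y, x).

(* Main.v *)
(** Given [R], take [Y = R], [f] the first projection and [g] the exchange of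
coordinates: the fibres over [a] and [b] are [{(a, b)}] and [{(b, a)}].

Conversely, [{(f y, f (g y))}] relates [a] to [b] only and only [a] to [b], but
its symmetrization may relate [b] to other points.  For [a <> b], separate [a]
and [b] by disjoint open sets [A] and [B], and keep only the pairs [(f y, f (g y))]
with [f y] outside [B] and [f (g y)] outside [A]; the symmetrization is now
harmless.  A point left without partner lies in [f (~ W)] and in [f (g (~ W))],
where [W] is the set of [y] with [f y] in [A] and [f (g y)] in [B].  The
intersection of these two sets is closed and avoids [a] and [b], so its points
can be related to themselves.  For [a = b] the diagonal works. *)

Require Import Defs.
From mathcomp Require Import all_boot.
From mathcomp Require Import all_classical topology.

Local Open Scope classical_set_scope.

(** As [hausdorff_space] asks cluster points of [nbhs p] to equal [p], this pulls Hausdorffness back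
    along continuous maps that jointly separate points. *)
Lemma cluster_nbhs_continuous {T U : topologicalType} (f : T -> U) {p q : T} :
  continuous f -> cluster (nbhs p) q -> cluster (nbhs (f p)) (f q).
Proof.
move=> fcont clpq A B /fcont fA /fcont fB.
by have [x [Ax Bx]] := clpq _ _ fA fB; exists (f x).
Qed.

Lemma fst_continuous (T U : topologicalType) : continuous (@fst T U).
Proof. by move=> p; exact: cvg_fst. Qed.

Lemma snd_continuous (T U : topologicalType) : continuous (@snd T U).
Proof. by move=> p; exact: cvg_snd. Qed.

Lemma pair_continuous {S T U : topologicalType} {f : S -> T} {g : S -> U} :
  continuous f -> continuous g -> continuous (fun x => (f x, g x)).
Proof. by move=> fcont gcont x; apply: cvg_pair; [exact: fcont|exact: gcont]. Qed.

Lemma hausdorff_prod (T U : topologicalType) :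
  hausdorff_space T -> hausdorff_space U -> hausdorff_space (T * U)%type.
Proof.
move=> hT hU [p1 p2] [q1 q2] clpq; congr (_, _).
  exact: hT (cluster_nbhs_continuous _ (@fst_continuous T U) clpq).
exact: hU (cluster_nbhs_continuous _ (@snd_continuous T U) clpq).
Qed.

Lemma hausdorff_set_type (T : topologicalType) (A : set T) :
  hausdorff_space T -> hausdorff_space (set_type A).
Proof.
move=> hT p q clpq; apply: val_inj; apply: hT.
exact: (cluster_nbhs_continuous _ (@initial_continuous _ _ _) clpq).
Qed.

(** A filter on the subtype, pushed forward to [T], clusters at a point of [A]; it clusters there in
    the subtype too, whose open sets are traces of open sets of [T]. *)
Lemma compact_set_type (T : topologicalType) (A : set T) :
  compact A -> compact [set: set_type A].
Proof.
move=> cA F FF _.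
have FA : (set_val @ F) A by apply: nearW => x; exact: set_valP.
have [x [Ax clx]] := cA (set_val @ F) _ FA.
exists (SigSub (mem_set Ax)); split => // B C FB.
rewrite nbhsE => -[_ [[D oD <-] Dx] DC].
have FvB : F (set_val @^-1` (set_val @` B)).
  by apply: filterS FB; exact: preimage_image.
have [_ [[y By <-] Dy]] := clx _ _ FvB (open_nbhs_nbhs (conj oD Dx)).
by exists y; split=> //; exact: DC.
Qed.

Lemma compact_continuous_image {S T : topologicalType} {f : S -> T} {A : set S} :
  continuous f -> compact A -> compact (f @` A).
Proof. by move=> fcont; apply: continuous_compact; exact: continuous_subspaceT. Qed.

Lemma pin_equivalent_of_relation {X : topologicalType} {a b : X}
    {R : set (X * X)} :
  compact_space X -> symmetric_relation R -> R.`1 = [set: X] -> closed R ->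
  (forall x, (R (a, x) <-> x = b) /\ (R (b, x) <-> x = a)) ->
  pin_equivalent a b.
Proof.
move=> [cX hX] symR domR clR Rab.
have swapR (p : set_type R) : swap_pair (val p) \in R.
  by case: p => [[x y] Rxy]; apply/mem_set/symR; exact: set_mem Rxy.
pose f (p : set_type R) : X := (val p).1.
pose g (p : set_type R) : set_type R := SigSub (swapR p).
have vcont : continuous (val : set_type R -> X * X).
  exact: initial_continuous.
have gK : involutive g by move=> p; apply: val_inj => /=; case: (val p).
have gcont : continuous g.
  apply: continuous_comp_initial => p.
  exact: (continuous_comp (vcont p) (@swap_continuous _ _ (val p))).
exists (set_type R), f, g; split.
- split; last exact/hausdorff_set_type/hausdorff_prod.
  apply/compact_set_type/(subclosed_compact clR (compact_setX cX cX)) => //.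
- by move=> p; exact: (continuous_comp (vcont p) (@fst_continuous _ _ (val p))).
- move=> x _; have [y Rxy] : R.`1 x by rewrite domR.
  by exists (SigSub (mem_set Rxy)).
- by split=> //; exists g; split.
(* [Rab] determines the second coordinate of a pair in [R] that starts at [a] or at [b]. *)
- apply/seteqP; split=> [_ [p /= fpa <-]|p /= fpb].
    have : R (val p) := set_valP p.
    by move: fpa; rewrite /f /=; case: (val p) => u v /= -> /(Rab v).1.
  exists (g p); last exact: gK.
  have : R (val p) := set_valP p.
  by move: fpb; rewrite /f /=; case: (val p) => u v /= -> /(Rab v).2.
Qed.

Lemma relation_of_pin_equivalent {X : topologicalType} {a b : X} :
  compact_space X -> pin_equivalent a b ->
  exists R : set (X * X),
    [/\ symmetric_relation R,
        R.`1 = [set: X],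
        closed R &
        forall x : X, (R (a, x) <-> x = b) /\ (R (b, x) <-> x = a)].
Proof.
move=> [cX hX] [Y [f [g [[cY _] fcont fsurj [gcont [h [_ gK hK]]] gab]]]].
(* Injectivity of [g] makes the equality of fibres [gab] a pointwise equivalence. *)
have fgab y : f y = a <-> f (g y) = b.
  split=> [fya|fgyb].
    by have : (f @^-1` [set b]) (g y) by rewrite -gab; exists y.
  have : (f @^-1` [set b]) (g y) by [].
  by rewrite -gab => -[z fza /(can_inj gK) <-].
have dcont : continuous (fun x : X => (x, x)).
  by apply: pair_continuous => x; exact.
have hXX := hausdorff_prod _ _ hX hX.
have [ab|ab] := eqVneq a b.
  exists (range (fun x : X => (x, x))); split.
  - by move=> _ _ [x _ [<- <-]]; exists x.
  - by apply/seteqP; split=> // x _; exists x, x.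
  - by apply: compact_closed => //; exact: compact_continuous_image dcont cX.
  - rewrite -ab => x.
    by split; (split=> [[_ _ [-> ->]]//|->]; exists a).
have fgcont : continuous (f \o g).
  by move=> y; apply: continuous_comp; [exact: gcont|exact: fcont].
have [[A B] /= [/set_mem Aa /set_mem Bb] [oA oB /eqP AB0]] :
    exists2 AB, (a \in AB.1 /\ b \in AB.2) &
      [/\ open AB.1, open AB.2 & AB.1 `&` AB.2 == set0].
  by move: hX; rewrite open_hausdorff; apply; exact: ab.
have AB x : A x -> B x -> False.
  by move=> Ax Bx; have : (A `&` B) x by []; rewrite AB0.
have oU (k : Y -> X) (U : set X) : continuous k -> open U -> open (k @^-1` U).
  by move=> kcont; apply: open_comp => y _; exact: kcont.
have clC (U : set Y) : open U -> compact (~` U).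
  by move=> oU'; apply: (subclosed_compact _ cY) => //; exact: open_closedC.
pose W := f @^-1` A `&` (f \o g) @^-1` B.
pose K := ~` (f @^-1` B `|` (f \o g) @^-1` A).
have cW : compact (~` W) by apply: clC; apply: openI; exact: oU.
have cK : compact K by apply: clC; apply: openU; exact: oU.
have WK y : W y -> K y by move=> [Ay By] [/(AB _ Ay)|/AB /(_ By)].
pose S := (fun y => (f y, f (g y))) @` K.
pose D := f @` (~` W) `&` (f \o g) @` (~` W).
(* By [fgab], [f y = a] and [f (g y) = b] each put [y] in [W]: the first factor of [D] misses [a],
   the second misses [b]. *)
have Da : ~ D a.
  move=> [[y nWy fya] _]; apply: nWy.
  by split; rewrite /= ?fya ?((fgab y).1 fya).
have Db : ~ D b.
  move=> [_ [y nWy /= fyb]]; apply: nWy.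
  by split; rewrite /= ?((fgab y).2 fyb) ?fyb.
have cS : compact S.
  exact: compact_continuous_image (pair_continuous fcont fgcont) cK.
have cD : compact D.
  apply: compact_closedI; first exact: compact_continuous_image fcont cW.
  by apply: compact_closed => //; exact: compact_continuous_image fgcont cW.
pose R := S `|` swap_pair @` S `|` (fun x : X => (x, x)) @` D.
have symR : symmetric_relation R.
  move=> x y [[Sxy|[[u v] Suv [<- <-]]]|[z Dz [<- <-]]].
  - by left; right; exists (x, y).
  - by left; left.
  - by right; exists z.
have domR : R.`1 = [set: X].
  apply/seteqP; split=> // x _.
  (* If [x] is outside one of the two images, its whole fibre under that map lies in [W], hence in
     [K]. For [f \o g], the point [h z] is in this fibre. *)
  have [[y nWy fyx]|nfx] := pselect ((f @` (~` W)) x); last first.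
    have [y _ fyx] := fsurj x I.
    exists (f (g y)); left; left; exists y; last by rewrite fyx.
    by apply: WK; apply: contrapT => nWy; apply: nfx; exists y.
  have [Wx|nfgx] := pselect (((f \o g) @` (~` W)) x).
    by exists x; right; exists x => //; split => //; exists y.
  have [z _ fzx] := fsurj x I.
  exists (f (h z)); left; right; exists (f (h z), x) => //.
  exists (h z); last by rewrite hK fzx.
  apply: WK; apply: contrapT => nWz; apply: nfgx; exists (h z) => //=.
  by rewrite hK.
(* Direct pairs from [a] end at [b] by [fgab]; a reversed one would put [f (g y) = a] in [A],
   against [K]. From [b] it is the direct pairs that [K] excludes. *)
have Rab x : R (a, x) -> x = b.
  move=> [[[y Ky [fya <-]]|[[u v] [y Ky [_ fgyv]] [va _]]]|[z Dz [za _]]].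
  - exact/fgab.
  - by exfalso; apply: Ky; right; rewrite /= fgyv va.
  - by move: Dz; rewrite za.
have Rba x : R (b, x) -> x = a.
  move=> [[[y Ky [fyb _]]|[[u v] [y Ky [fyu fgyv]] [vb <-]]]|[z Dz [zb _]]].
  - by exfalso; apply: Ky; left; rewrite /= fyb.
  - by rewrite -fyu; apply/fgab; rewrite fgyv.
  - by move: Dz; rewrite zb.
(* Some partner of [a] exists by [domR], and [Rab] leaves only [b]. *)
have RabT : R (a, b).
  have [x Rax] : R.`1 a by rewrite domR.
  by rewrite -(Rab x).
exists R; split => //.
- apply: compact_closed => //; apply: compactU; first apply: compactU => //.
    exact: compact_continuous_image swap_continuous cS.
  exact: compact_continuous_image dcont cD.
- move=> x; split; split=> [|->//]; [exact: Rab|exact: Rba|exact: symR].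
Qed.

Theorem theorem2p1 (X : topologicalType) (hX : compact_space X) (a b : X) :
  pin_equivalent a b <->
  exists R : set (X * X),
    [/\ symmetric_relation R,
        R.`1 = [set: X],
        closed R &
        forall x : X, (R (a, x) <-> x = b) /\ (R (b, x) <-> x = a)].
Proof.
split; first exact: relation_of_pin_equivalent.
by move=> [R [symR domR clR Rab]]; exact: pin_equivalent_of_relation Rab.
Qed.
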